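(* Let $(H,\Phi,\mathcal{R},\chi)$ be a pre-Cartier quasi-bialgebra. Then the following identity (the quasi counterpart of the infinitesimal quantum Yang--Baxter equation) holds in $H^{\otimes 3}$: $$\begin{aligned}&\mathcal{R}_{12}\chi_{12}\Phi_{231}\mathcal{R}_{13}\Phi_{132}^{-1}\mathcal{R}_{23}\Phi+\mathcal{R}_{12}\Phi_{231}\mathcal{R}_{13}\chi_{13}\Phi_{132}^{-1}\mathcal{R}_{23}\Phi+\mathcal{R}_{12}\Phi_{231}\mathcal{R}_{13}\Phi_{132}^{-1}\mathcal{R}_{23}\chi_{23}\Phi\\ &=\Phi_{321}\mathcal{R}_{23}\chi_{23}\Phi_{312}^{-1}\mathcal{R}_{13}\Phi_{213}\mathcal{R}_{12}+\Phi_{321}\mathcal{R}_{23}\Phi_{312}^{-1}\mathcal{R}_{13}\chi_{13}\Phi_{213}\mathcal{R}_{12}+\Phi_{321}\mathcal{R}_{23}\Phi_{312}^{-1}\mathcal{R}_{13}\Phi_{213}\mathcal{R}_{12}\chi_{12}.\end{aligned}$$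
   Context: $\Bbbk$ is a field of characteristic zero; all algebras are associative unital $\Bbbk$-algebras, all maps are $\Bbbk$-linear, $\otimes=\otimes_\Bbbk$, and $\tau$ is the tensor flip. Leg notation: for $A=\sum A^1\otimes A^2\in H\otimes H$, put $A^{\mathrm{op}}=\tau(A)$, $A_{12}=A\otimes 1$, $A_{23}=1\otimes A$, $A_{13}=\sum A^1\otimes 1\otimes A^2$. For $\Phi=\sum\Phi^1\otimes\Phi^2\otimes\Phi^3\in H^{\otimes 3}$ and a permutation $(i,j,k)$ of $(1,2,3)$, put $\Phi_{ijk}=\sum\Phi^i\otimes\Phi^j\otimes\Phi^k$. A quasi-bialgebra is an algebra $H$ with algebra morphisms $\Delta\colon H\to H\otimes H$, $\varepsilon\colon H\to\Bbbk$ and invertible elements $\Phi\in H^{\otimes 3}$, $\ell,r\in H$ such that for all $h\in H$: $(\mathrm{id}\otimes\Delta)\Delta(h)=\Phi\,(\Delta\otimes\mathrm{id})\Delta(h)\,\Phi^{-1}$, $(\varepsilon\otimes\mathrm{id})\Delta(h)=\ell^{-1}h\ell$, $(\mathrm{id}\otimes\varepsilon)\Delta(h)=r^{-1}hr$, and $(\mathrm{id}\otimes\mathrm{id}\otimes\Delta)(\Phi)(\Delta\otimes\mathrm{id}\otimes\mathrm{id})(\Phi)=(1\otimes\Phi)(\mathrm{id}\otimes\Delta\otimes\mathrm{id})(\Phi)(\Phi\otimes 1)$, $(\mathrm{id}\otimes\varepsilon\otimes\mathrm{id})(\Phi)=r\otimes\ell^{-1}$. It is quasitriangular if it is endowed with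 an invertible $\mathcal{R}\in H\otimes H$ with $\Delta^{\mathrm{op}}(\cdot)=\mathcal{R}\Delta(\cdot)\mathcal{R}^{-1}$, $(\mathrm{id}\otimes\Delta)(\mathcal{R})=\Phi_{312}^{-1}\mathcal{R}_{13}\Phi_{213}\mathcal{R}_{12}\Phi^{-1}$, $(\Delta\otimes\mathrm{id})(\mathcal{R})=\Phi_{231}\mathcal{R}_{13}\Phi_{132}^{-1}\mathcal{R}_{23}\Phi$. A pre-Cartier quasi-bialgebra is a quasitriangular quasi-bialgebra together with an element $\chi\in H\otimes H$ (infinitesimal $\mathcal{R}$-matrix) with $\chi\Delta(\cdot)=\Delta(\cdot)\chi$, $(\mathrm{id}\otimes\Delta)(\chi)=\Phi\mathcal{R}_{12}^{-1}\Phi_{213}^{-1}\chi_{13}\Phi_{213}\mathcal{R}_{12}\Phi^{-1}+\Phi\chi_{12}\Phi^{-1}$, $(\Delta\otimes\mathrm{id})(\chi)=\Phi^{-1}\mathcal{R}_{23}^{-1}\Phi_{132}\chi_{13}\Phi_{132}^{-1}\mathcal{R}_{23}\Phi+\Phi^{-1}\chi_{23}\Phi$. *)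

(* Defs.v *)
From HB Require Import structures.
From mathcomp Require Import all_boot all_order all_algebra all_classical.

Set Implicit Arguments.
Unset Strict Implicit.
Unset Printing Implicit Defensive.

Import GRing.Theory.
Local Open Scope ring_scope.
Local Open Scope quotient_scope.

(* A subspace of a nonzero algebra maximal among those avoiding 1 is a
   hyperplane, which gives a linear form sending 1 to 1. It is only used to
   show that tensor powers are nonzero, as algType requires. *)
Section UnitForm.
Variables (k : fieldType) (H : algType k).

Let subsp (A : set H) := forall a u v, A u -> A v -> A (a *: u + v).
Let good (A : set H) := [/\ A 0, subsp A & ~ A 1].

Lemma exists_unit_form :
  exists phi : H -> k,
    (forall a u v, phi (a *: u + v) = a * phi u + phi v) /\ phi 1 = 1.
Proof.
pose good0 (A : set H) := A = classical_sets.set0 \/ good A.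
have [A [gA maxA]] : exists A, good0 A /\
    forall B, classical_sets.proper A B -> ~ good0 B.
  apply: Zorn_bigcup => F FP Ftot.
  have [[B FB [x Bx]]|noF] := pselect (exists2 B, F B & exists x, B x); last first.
    left; apply/seteqP; split => // x [B FB Bx]; apply: noF.
    by exists B => //; exists x.
  have good_of C y : F C -> C y -> good C.
    by move=> FC Cy; case: (FP _ FC) => [C0|//]; rewrite C0 in Cy.
  right; split.
  - by exists B => //; case: (good_of _ _ FB Bx).
  - move=> a u v [C FC Cu] [D FD Dv].
    case: (Ftot _ _ FC FD) => [sCD|sDC].
      exists D => //; case: (good_of _ _ FD Dv) => _ sD _.
      by apply: sD => //; exact: sCD.
    exists C => //; case: (good_of _ _ FC Cu) => _ sC _.
    by apply: sC => //; exact: sDC.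
  - by move=> [C FC C1]; case: (good_of _ _ FC C1).
have {}gA : good A.
  case: gA => // A0; exfalso; apply: (maxA (fun x => x = 0)).
    by rewrite A0; split => // /(_ 0 erefl).
  right; split => //.
    by move=> a u v -> ->; rewrite scaler0 addr0.
  by move/eqP; rewrite oner_eq0.
case: gA => A0 sA nA1.
have AD u v : A u -> A v -> A (u + v).
  by move=> Au Av; rewrite -[u]scale1r; exact: sA.
have AZ a u : A u -> A (a *: u) by move=> Au; rewrite -[_ *: _]addr0; exact: sA.
have AN u : A u -> A (- u) by move=> Au; rewrite -scaleN1r; exact: AZ.
have dec v : exists c : k, A (v - c *: 1).
  have [//|nex] := pselect (exists c : k, A (v - c *: 1)).
  exfalso; apply: (maxA (fun x => exists c : k, A (x - c *: v))).
    split; first by move=> x Ax; exists 0; rewrite scale0r subr0.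
    move=> /(_ v) h; apply: nex; exists 0; rewrite scale0r subr0; apply: h.
    by exists 1; rewrite scale1r subrr.
  right; split.
  - by exists 0; rewrite scale0r subr0.
  - move=> a x y [c Ac] [d Ad]; exists (a * c + d).
    rewrite scalerDl -scalerA opprD addrACA -scalerBr; exact: sA.
  - move=> [c Ac]; have [c0|c0] := eqVneq c 0.
      by apply: nA1; move: Ac; rewrite c0 scale0r subr0.
    apply: nex; exists c^-1.
    have := AZ (- c^-1) _ Ac.
    by rewrite scalerBr scalerA mulNr mulVf// scaleN1r opprK scaleNr addrC.
pose phi v := projT1 (cid (dec v)).
have phiP v : A (v - phi v *: 1) by exact: projT2 (cid (dec v)).
have uniq v c d : A (v - c *: 1) -> A (v - d *: 1) -> c = d.
  move=> Ac Ad; apply/eqP; rewrite -subr_eq0; apply/negP => /negP cd.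
  apply: nA1.
  have : A ((c - d) *: 1).
    by have := AD _ _ (AN _ Ac) Ad; rewrite opprB addrA subrK -scalerBl.
  by move=> /(AZ (c - d)^-1); rewrite scalerA mulVf// scale1r.
exists phi; split; last first.
  by apply: (uniq 1) (phiP 1) _; rewrite scale1r subrr.
move=> a u v; apply: uniq (phiP _) _.
by rewrite scalerDl -scalerA opprD addrACA -scalerBr; exact: sA.
Qed.

End UnitForm.

(* The tensor power H^{(x) n}: formal linear combinations of n-tuples, two of
   them being identified when no multilinear map separates them. This makes
   tlift_unique and tlift_tpure (the universal property) hold. *)
Section TensorPower.
Variables (k : fieldType) (H : algType k) (n : nat).

Definition tupd (x : n.-tuple H) (i : 'I_n) (a : H) : n.-tuple H :=
  [tuple if j == i then a else tnth x j | j < n].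

Definition multilinear (W : lmodType k) (f : n.-tuple H -> W) : Prop :=
  forall (x : n.-tuple H) (i : 'I_n) (a : k) (u v : H),
    f (tupd x i (a *: u + v)) = a *: f (tupd x i u) + f (tupd x i v).

Definition feval (W : lmodType k) (f : n.-tuple H -> W)
  (s : seq (k * n.-tuple H)) : W := \sum_(p <- s) p.1 *: f p.2.

Definition teq : rel (seq (k * n.-tuple H)) := fun s t =>
  `[< forall (W : lmodType k) (f : n.-tuple H -> W),
        multilinear f -> feval f s = feval f t >].

Lemma teq_is_equiv : equiv_class_of teq.
Proof.
split=> [s|s t|t s u].
- by apply/asboolP.
- by apply/asboolP/asboolP => h W f mf; rewrite h.
- by move=> /asboolP h1 /asboolP h2; apply/asboolP => W f mf; rewrite h1// h2.
Qed.

Canonical teq_equiv := EquivRelPack teq_is_equiv.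

Definition tens : Type := {eq_quot teq_equiv}.
HB.instance Definition _ := Choice.on tens.
HB.instance Definition _ := EqQuotient.on tens.

Definition tpure (x : n.-tuple H) : tens := \pi_tens [:: (1, x)].

(* The linear extension of f; only meaningful when f is multilinear. *)
Definition tlift (W : lmodType k) (f : n.-tuple H -> W) (x : tens) : W :=
  feval f (repr x).

Lemma tlift_pi (W : lmodType k) (f : n.-tuple H -> W) s :
  multilinear f -> tlift f (\pi_tens s) = feval f s.
Proof.
move=> mf; rewrite /tlift.
have /eqquotP/asboolP : repr (\pi_tens s) = s %[mod {eq_quot teq_equiv}].
  by rewrite reprK.
exact.
Qed.

Lemma tens_eqP (x y : tens) :
  (forall (W : lmodType k) (f : n.-tuple H -> W),
     multilinear f -> tlift f x = tlift f y) -> x = y.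
Proof.
move=> h; rewrite -[x]reprK -[y]reprK; apply/eqquotP/asboolP.
by move=> W f mf; exact: h.
Qed.

Definition pmul (x y : n.-tuple H) : n.-tuple H :=
  [tuple tnth x i * tnth y i | i < n].

Definition pone : n.-tuple H := [tuple 1 | _ < n].

Definition tzero : tens := \pi_tens [::].
Definition tadd (x y : tens) : tens := \pi_tens (repr x ++ repr y).
Definition topp (x : tens) : tens := \pi_tens [seq (- p.1, p.2) | p <- repr x].
Definition tscale (a : k) (x : tens) : tens :=
  \pi_tens [seq (a * p.1, p.2) | p <- repr x].
Definition tmul (x y : tens) : tens :=
  \pi_tens [seq (p.1 * q.1, pmul p.2 q.2) | p <- repr x, q <- repr y].

Fact tlift0 (W : lmodType k) (f : n.-tuple H -> W) : multilinear f ->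
  tlift f tzero = 0.
Proof. by move=> mf; rewrite tlift_pi// /feval big_nil. Qed.

Fact tliftD (W : lmodType k) (f : n.-tuple H -> W) x y : multilinear f ->
  tlift f (tadd x y) = tlift f x + tlift f y.
Proof. by move=> mf; rewrite tlift_pi// /feval big_cat. Qed.

Fact tliftN (W : lmodType k) (f : n.-tuple H -> W) x : multilinear f ->
  tlift f (topp x) = - tlift f x.
Proof.
move=> mf; rewrite tlift_pi// /feval big_map /tlift /feval -sumrN.
by apply: eq_bigr => p _; rewrite scaleNr.
Qed.

Fact tliftZ (W : lmodType k) (f : n.-tuple H -> W) a x : multilinear f ->
  tlift f (tscale a x) = a *: tlift f x.
Proof.
move=> mf; rewrite tlift_pi// /feval big_map /tlift /feval scaler_sumr.
by apply: eq_bigr => p _; rewrite scalerA.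
Qed.

Lemma tlift_tpure (W : lmodType k) (f : n.-tuple H -> W) x : multilinear f ->
  tlift f (tpure x) = f x.
Proof. by move=> mf; rewrite tlift_pi// /feval big_seq1 scale1r. Qed.

Definition tlift_ops := (tlift0, tliftD, tliftN, tliftZ).

Fact taddA : associative tadd.
Proof. by move=> x y z; apply: tens_eqP => W f mf; rewrite !tlift_ops// addrA. Qed.
Fact taddC : commutative tadd.
Proof. by move=> x y; apply: tens_eqP => W f mf; rewrite !tlift_ops// addrC. Qed.
Fact tadd0 : left_id tzero tadd.
Proof. by move=> x; apply: tens_eqP => W f mf; rewrite !tlift_ops// add0r. Qed.
Fact taddN : left_inverse tzero topp tadd.
Proof. by move=> x; apply: tens_eqP => W f mf; rewrite !tlift_ops// addNr. Qed.

HB.instance Definition _ := GRing.isZmodule.Build tens taddA taddC tadd0 taddN.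

Fact tscaleA a b x : tscale a (tscale b x) = tscale (a * b) x.
Proof. by apply: tens_eqP => W f mf; rewrite !tlift_ops// scalerA. Qed.
Fact tscale1 : left_id 1 tscale.
Proof. by move=> x; apply: tens_eqP => W f mf; rewrite !tlift_ops// scale1r. Qed.
Fact tscaleDr : right_distributive tscale +%R.
Proof.
by move=> a x y; apply: tens_eqP => W f mf; rewrite !tlift_ops// scalerDr.
Qed.
Fact tscaleDl x : {morph tscale^~ x : a b / a + b}.
Proof.
by move=> a b; apply: tens_eqP => W f mf; rewrite !tlift_ops// scalerDl.
Qed.

HB.instance Definition _ :=
  GRing.Zmodule_isLmodule.Build k tens tscaleA tscale1 tscaleDr tscaleDl.

Lemma tlift_is_linear (W : lmodType k) (f : n.-tuple H -> W) :
  multilinear f -> linear (tlift f).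
Proof. by move=> mf a x y; rewrite !tlift_ops. Qed.

Lemma tpure_multilinear : multilinear tpure.
Proof.
move=> x i a u v; apply: tens_eqP => W f mf.
by rewrite tlift_is_linear// !tlift_tpure.
Qed.

Lemma tens_sumE (x : tens) : x = \sum_(p <- repr x) p.1 *: tpure p.2.
Proof.
rewrite -/(feval tpure (repr x)) -/(tlift tpure x).
apply: tens_eqP => W f mf.
have lf : tlift f (tlift tpure x) = \sum_(p <- repr x) p.1 *: f p.2.
  rewrite {2}/tlift /feval; elim: (repr x) => [|p s ihs].
    by rewrite !big_nil tlift_ops.
  by rewrite !big_cons tlift_is_linear// ihs tlift_tpure.
by rewrite lf.
Qed.

Lemma tlift_unique (W : lmodType k) (f : n.-tuple H -> W) (g : tens -> W) :
  linear g -> (forall x, g (tpure x) = f x) -> g =1 tlift f.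
Proof.
move=> lg gf x; rewrite {1}(tens_sumE x) /tlift /feval.
have g0 : g 0 = 0.
  by have := lg (-1) 0 0; rewrite scaleN1r addNr scaleN1r addNr.
elim: (repr x) => [|p s ihs]; first by rewrite !big_nil.
by rewrite !big_cons lg ihs gf.
Qed.

Lemma eq_tlift (W : lmodType k) (f g : n.-tuple H -> W) :
  f =1 g -> tlift f =1 tlift g.
Proof. by move=> fg x; apply: eq_bigr => p _; rewrite fg. Qed.

Lemma pmul_updl x y i u :
  pmul (tupd x i u) y = tupd (pmul x y) i (u * tnth y i).
Proof.
apply: eq_from_tnth => j; rewrite !tnth_mktuple.
by case: eqP => // ->.
Qed.

Lemma pmul_updr x y i u :
  pmul x (tupd y i u) = tupd (pmul x y) i (tnth x i * u).
Proof.
apply: eq_from_tnth => j; rewrite !tnth_mktuple.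
by case: eqP => // ->.
Qed.

Lemma pmulA : associative pmul.
Proof. by move=> x y z; apply: eq_from_tnth => j; rewrite !tnth_mktuple mulrA. Qed.

Lemma pmul1x : left_id pone pmul.
Proof. by move=> x; apply: eq_from_tnth => j; rewrite !tnth_mktuple mul1r. Qed.

Lemma pmulx1 : right_id pone pmul.
Proof. by move=> x; apply: eq_from_tnth => j; rewrite !tnth_mktuple mulr1. Qed.

Fact multi_pmulr (W : lmodType k) (f : n.-tuple H -> W) x :
  multilinear f -> multilinear (fun y => f (pmul x y)).
Proof.
move=> mf y i a u v; rewrite !pmul_updr.
by rewrite mulrDr -scalerAr mf.
Qed.

Fact multi_pmull (W : lmodType k) (f : n.-tuple H -> W) y :
  multilinear f -> multilinear (fun x => f (pmul x y)).
Proof.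
move=> mf x i a u v; rewrite !pmul_updl.
by rewrite mulrDl -scalerAl mf.
Qed.

Fact multi_tlift_pmul (W : lmodType k) (f : n.-tuple H -> W) y :
  multilinear f -> multilinear (fun x => tlift (fun v => f (pmul x v)) y).
Proof.
move=> mf x i a u v; rewrite /tlift /feval scaler_sumr -big_split /=.
apply: eq_bigr => p _; rewrite multi_pmull// scalerDr !scalerA.
by rewrite mulrC.
Qed.

Fact tlift_tmul (W : lmodType k) (f : n.-tuple H -> W) x y : multilinear f ->
  tlift f (tmul x y) = tlift (fun u => tlift (fun v => f (pmul u v)) y) x.
Proof.
move=> mf; rewrite tlift_pi// /feval big_allpairs_dep /= /tlift /feval.
apply: eq_bigr => p _; rewrite scaler_sumr; apply: eq_bigr => q _.
by rewrite scalerA.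
Qed.

Fact tmulA : associative tmul.
Proof.
move=> x y z; apply: tens_eqP => W f mf; rewrite !tlift_tmul//.
  apply: eq_tlift => u; rewrite tlift_tmul; last exact: multi_pmulr.
  apply: eq_tlift => v; apply: eq_tlift => w.
  by rewrite pmulA.
exact: multi_tlift_pmul.
Qed.

Fact tmul1 : left_id (tpure pone) tmul.
Proof.
move=> x; apply: tens_eqP => W f mf; rewrite tlift_tmul// tlift_tpure.
  by apply: eq_tlift => u; rewrite pmul1x.
exact: multi_tlift_pmul.
Qed.

Fact tmulx1 : right_id (tpure pone) tmul.
Proof.
move=> x; apply: tens_eqP => W f mf; rewrite tlift_tmul//.
by apply: eq_tlift => u; rewrite tlift_tpure ?pmulx1//; exact: multi_pmulr.
Qed.

Fact tmulDl : left_distributive tmul +%R.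
Proof.
move=> x y z; apply: tens_eqP => W f mf; rewrite tlift_tmul// !tlift_ops//.
  by rewrite !tlift_tmul.
exact: multi_tlift_pmul.
Qed.

Fact tlift_addf (W : lmodType k) (f g : n.-tuple H -> W) x :
  tlift (fun u => f u + g u) x = tlift f x + tlift g x.
Proof.
rewrite /tlift /feval -big_split /=.
by apply: eq_bigr => p _; rewrite scalerDr.
Qed.

Fact tlift_scalef (W : lmodType k) (f : n.-tuple H -> W) a x :
  tlift (fun u => a *: f u) x = a *: tlift f x.
Proof.
rewrite /tlift /feval scaler_sumr.
by apply: eq_bigr => p _; rewrite !scalerA mulrC.
Qed.

Fact tmulDr : right_distributive tmul +%R.
Proof.
move=> x y z; apply: tens_eqP => W f mf.
rewrite tlift_ops// !tlift_tmul// -tlift_addf.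
by apply: eq_tlift => u; rewrite tlift_ops//; exact: multi_pmulr.
Qed.

Fact tone_neq0 : tpure pone != 0.
Proof.
have [phi [lphi phi1]] := exists_unit_form H.
pose f (x : n.-tuple H) : k^o := \prod_(i < n) phi (tnth x i).
have mf : multilinear f.
  move=> x i a u v.
  have e w : f (tupd x i w) =
      phi w * \prod_(j < n | j != i) phi (tnth x j).
    rewrite /f (bigD1 i) //= tnth_mktuple eqxx; congr (_ * _).
    by apply: eq_bigr => j /negPf ji; rewrite tnth_mktuple ji.
  by rewrite !e lphi mulrDl -mulrA.
apply/eqP => /(congr1 (tlift f)); rewrite tlift_tpure// tlift_ops//.
rewrite /f big1 => [/eqP|i _]; first by rewrite oner_eq0.
by rewrite tnth_mktuple phi1.
Qed.

HB.instance Definition _ := GRing.Zmodule_isNzRing.Build tens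
  tmulA tmul1 tmulx1 tmulDl tmulDr tone_neq0.

Fact tscaleAl a (x y : tens) : a *: (x * y) = a *: x * y.
Proof.
apply: tens_eqP => W f mf; rewrite tlift_ops// !tlift_tmul// tlift_ops//.
exact: multi_tlift_pmul.
Qed.

HB.instance Definition _ := GRing.Lmodule_isLalgebra.Build k tens tscaleAl.

Fact tscaleAr a (x y : tens) : a *: (x * y) = x * (a *: y).
Proof.
apply: tens_eqP => W f mf; rewrite tlift_ops// !tlift_tmul// -tlift_scalef.
by apply: eq_tlift => u; rewrite tlift_ops//; exact: multi_pmulr.
Qed.

HB.instance Definition _ := GRing.Lalgebra_isAlgebra.Build k tens tscaleAr.

Lemma tpureM x y : tpure x * tpure y = tpure (pmul x y).
Proof.
apply: tens_eqP => W f mf; rewrite tlift_tmul// !tlift_tpure//.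
- exact: multi_pmulr.
- exact: multi_tlift_pmul.
Qed.

Lemma tpure1 : tpure pone = 1.
Proof. by []. Qed.

Definition tinvertible (x y : tens) : Prop := y * x = 1 /\ x * y = 1.

Definition tunit : pred tens := fun x => `[< exists y, tinvertible x y >].

Definition tinv (x : tens) : tens :=
  if pselect (exists y, tinvertible x y) is left h then projT1 (cid h) else x.

Fact tinvP x : tunit x -> tinvertible x (tinv x).
Proof. by move=> /asboolP h; rewrite /tinv; case: pselect => // ?; case: cid. Qed.

Fact tmulVx : {in tunit, left_inverse 1 tinv *%R}.
Proof. by move=> x /tinvP[]. Qed.
Fact tmulxV : {in tunit, right_inverse 1 tinv *%R}.
Proof. by move=> x /tinvP[]. Qed.
Fact tunitP x y : y * x = 1 /\ x * y = 1 -> tunit x.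
Proof. by move=> h; apply/asboolP; exists y. Qed.
Fact tinv_out : {in [predC tunit], tinv =1 id}.
Proof. by move=> x /asboolP h; rewrite /tinv; case: pselect. Qed.

HB.instance Definition _ :=
  GRing.NzRing_hasMulInverse.Build tens tmulVx tmulxV tunitP tinv_out.

End TensorPower.

Section Legs.
Variables (k : fieldType) (H : algType k).

Definition ten2 (a b : H) : tens H 2 := tpure [tuple a; b].
Definition ten3 (a b c : H) : tens H 3 := tpure [tuple a; b; c].
Definition ten4 (a b c d : H) : tens H 4 := tpure [tuple a; b; c; d].

Definition lift2 (W : lmodType k) (f : H -> H -> W) : tens H 2 -> W :=
  tlift (fun x => f x`_0 x`_1).
Definition lift3 (W : lmodType k) (f : H -> H -> H -> W) : tens H 3 -> W :=
  tlift (fun x => f x`_0 x`_1 x`_2).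

Definition flip (A : tens H 2) : tens H 2 := lift2 (fun a b => ten2 b a) A.

Definition leg12 (A : tens H 2) : tens H 3 := lift2 (fun a b => ten3 a b 1) A.
Definition leg13 (A : tens H 2) : tens H 3 := lift2 (fun a b => ten3 a 1 b) A.
Definition leg23 (A : tens H 2) : tens H 3 := lift2 (fun a b => ten3 1 a b) A.

(* The indices list the tensor factors of the argument in the order in which
   they appear: permIJK (a1 (x) a2 (x) a3) = aI (x) aJ (x) aK. *)
Definition perm132 (X : tens H 3) : tens H 3 := lift3 (fun a b c => ten3 a c b) X.
Definition perm213 (X : tens H 3) : tens H 3 := lift3 (fun a b c => ten3 b a c) X.
Definition perm231 (X : tens H 3) : tens H 3 := lift3 (fun a b c => ten3 b c a) X.
Definition perm312 (X : tens H 3) : tens H 3 := lift3 (fun a b c => ten3 c a b) X.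
Definition perm321 (X : tens H 3) : tens H 3 := lift3 (fun a b c => ten3 c b a) X.

Definition tens_one (X : tens H 3) : tens H 4 :=
  lift3 (fun a b c => ten4 a b c 1) X.
Definition one_tens (X : tens H 3) : tens H 4 :=
  lift3 (fun a b c => ten4 1 a b c) X.

Variable D : H -> tens H 2.

Definition D_id (A : tens H 2) : tens H 3 :=
  lift2 (fun a b => lift2 (fun u v => ten3 u v b) (D a)) A.
Definition id_D (A : tens H 2) : tens H 3 :=
  lift2 (fun a b => lift2 (fun u v => ten3 a u v) (D b)) A.

Definition D_id_id (X : tens H 3) : tens H 4 :=
  lift3 (fun a b c => lift2 (fun u v => ten4 u v b c) (D a)) X.
Definition id_D_id (X : tens H 3) : tens H 4 :=
  lift3 (fun a b c => lift2 (fun u v => ten4 a u v c) (D b)) X.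
Definition id_id_D (X : tens H 3) : tens H 4 :=
  lift3 (fun a b c => lift2 (fun u v => ten4 a b u v) (D c)) X.

Variable e : H -> k.

(* Here k (x) H and H (x) k are identified with H. *)
Definition e_id (A : tens H 2) : H := lift2 (fun a b => e a *: b) A.
Definition id_e (A : tens H 2) : H := lift2 (fun a b => e b *: a) A.
Definition id_e_id (X : tens H 3) : tens H 2 :=
  lift3 (fun a b c => e b *: ten2 a c) X.

End Legs.

(* unitAlgType is no restriction on the underlying algebra: its units are the
   two-sided invertible elements. Likewise, the counit forces 1 <> 0. *)
Record quasiBialgebra (k : fieldType) := QuasiBialgebra {
  qb_alg :> unitAlgType k;
  Delta : {lrmorphism qb_alg -> tens qb_alg 2};
  counit : {lrmorphism qb_alg -> k^o};
  Phi : tens qb_alg 3;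
  ell : qb_alg;
  rr : qb_alg;
  Phi_unit : Phi \is a GRing.unit;
  ell_unit : ell \is a GRing.unit;
  rr_unit : rr \is a GRing.unit;
  quasi_coassoc : forall h : qb_alg,
    id_D Delta (Delta h) = Phi * D_id Delta (Delta h) * Phi^-1;
  counit_l : forall h : qb_alg, e_id counit (Delta h) = ell^-1 * h * ell;
  counit_r : forall h : qb_alg, id_e counit (Delta h) = rr^-1 * h * rr;
  pentagon : id_id_D Delta Phi * D_id_id Delta Phi
           = one_tens Phi * id_D_id Delta Phi * tens_one Phi;
  triangle : id_e_id counit Phi = ten2 rr ell^-1
}.

Record quasitriangularQB (k : fieldType) := QuasitriangularQB {
  qt_qb :> quasiBialgebra k;
  Rmx : tens qt_qb 2;
  Rmx_unit : Rmx \is a GRing.unit;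
  quasi_cocomm : forall h : qt_qb,
    flip (Delta qt_qb h) = Rmx * Delta qt_qb h * Rmx^-1;
  hexagon_r : id_D (Delta qt_qb) Rmx
    = (perm312 (Phi qt_qb))^-1 * leg13 Rmx * perm213 (Phi qt_qb)
      * leg12 Rmx * (Phi qt_qb)^-1;
  hexagon_l : D_id (Delta qt_qb) Rmx
    = perm231 (Phi qt_qb) * leg13 Rmx * (perm132 (Phi qt_qb))^-1
      * leg23 Rmx * Phi qt_qb
}.

Record preCartierQB (k : fieldType) := PreCartierQB {
  pc_qt :> quasitriangularQB k;
  chi : tens pc_qt 2;
  chi_comm : forall h : pc_qt, chi * Delta pc_qt h = Delta pc_qt h * chi;
  chi_r : id_D (Delta pc_qt) chi
    = Phi pc_qt * (leg12 (Rmx pc_qt))^-1 * (perm213 (Phi pc_qt))^-1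
      * leg13 chi
      * perm213 (Phi pc_qt) * leg12 (Rmx pc_qt) * (Phi pc_qt)^-1
      + Phi pc_qt * leg12 chi * (Phi pc_qt)^-1;
  chi_l : D_id (Delta pc_qt) chi
    = (Phi pc_qt)^-1 * (leg23 (Rmx pc_qt))^-1 * perm132 (Phi pc_qt)
      * leg13 chi
      * (perm132 (Phi pc_qt))^-1 * leg23 (Rmx pc_qt) * Phi pc_qt
      + (Phi pc_qt)^-1 * leg23 chi * Phi pc_qt
}.

(* Main.v *)
From HB Require Import structures.
Require Import Defs.
From mathcomp Require Import all_boot all_order all_algebra.

Set Implicit Arguments.
Unset Strict Implicit.
Unset Printing Implicit Defensive.

Import GRing.Theory.
Local Open Scope ring_scope.

(** The identity is the first order part of a Yang-Baxter equation.  Write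
    [D = Delta (x) id] and let [s] exchange the first two tensor factors, so
    that [s o D] is [Delta^op (x) id].  Since [R] conjugates [Delta] into
    [Delta^op], one has [R12 D(A) = s(D(A)) R12] for every [A] in [H (x) H]
    ([leg12_quasi_cocomm]); for [A = R] the hexagon turns this into the quasi
    Yang-Baxter equation.  Replacing [R] by [R (1 + t chi)] and keeping the
    terms linear in [t] suggests how the proof goes.

    As [D] is multiplicative, the hexagon for [R] and the coproduct rule for
    [chi] give
      [D(R chi) = Phi231 R13 chi13 Phi132^-1 R23 Phi
                + Phi231 R13 Phi132^-1 R23 chi23 Phi]   ([D_id_Rchi]),
    so that the left-hand side is [R12 (chi12 D(R) + D(R chi))].  Now [chi12]
    commutes with [D(R)] because [chi] commutes with coproducts
    ([leg12_commute]), and moving [R12] to the right of each [D] yields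
    [s(D(R)) R12 chi12 + s(D(R chi)) R12].  Since [s] is an algebra morphism,
    it only permutes the legs in the two formulas for [D(R)] and [D(R chi)],
    and the right-hand side results. *)

(** * Linear maps out of tensor powers *)

Section Multilinear.
Variables (k : fieldType) (H : algType k).

Lemma eq_on_tpure n (W : lmodType k) (f g : tens H n -> W) :
  linear f -> linear g -> (forall x, f (tpure x) = g (tpure x)) -> f =1 g.
Proof.
move=> lf lg fg x.
by rewrite (tlift_unique lf fg) -(tlift_unique lg (fun y => erefl)).
Qed.

Definition bilinear2 (W : lmodType k) (f : H -> H -> W) : Prop :=
  (forall b, linear (f^~ b)) /\ (forall a, linear (f a)).

Definition trilinear3 (W : lmodType k) (f : H -> H -> H -> W) : Prop :=
  [/\ forall b c, linear (fun a => f a b c),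
      forall a c, linear (fun b => f a b c) & forall a b, linear (f a b)].

Lemma tuple2E (x : 2.-tuple H) : x = [tuple x`_0; x`_1].
Proof. by case: x => [[|a [|b []]]] // p; apply: val_inj. Qed.

Lemma tuple3E (x : 3.-tuple H) : x = [tuple x`_0; x`_1; x`_2].
Proof. by case: x => [[|a [|b [|c []]]]] // p; apply: val_inj. Qed.

Lemma nth_tupd n (x : n.-tuple H) (i : 'I_n) a j : (j < n)%N ->
  (tupd x i a)`_j = if j == i then a else x`_j.
Proof.
by move=> jn; rewrite -!(tnth_nth 0 _ (Ordinal jn)) tnth_mktuple.
Qed.

(** This translates linearity in each argument, which is easy to verify for
    concrete maps, into the coordinatewise form that [tlift] asks for. *)
Lemma multilinear2 (W : lmodType k) (f : H -> H -> W) :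
  bilinear2 f -> multilinear (fun x : 2.-tuple H => f x`_0 x`_1).
Proof.
move=> [f1 f2] x i a u v; rewrite !nth_tupd //.
case: i => -[|[|//]] lt_i2 /=.
- exact: f1.
- exact: f2.
Qed.

Lemma multilinear3 (W : lmodType k) (f : H -> H -> H -> W) :
  trilinear3 f -> multilinear (fun x : 3.-tuple H => f x`_0 x`_1 x`_2).
Proof.
move=> [f1 f2 f3] x i a u v; rewrite !nth_tupd //.
case: i => -[|[|[|//]]] lt_i3 /=.
- exact: f1.
- exact: f2.
- exact: f3.
Qed.

Lemma lift2_linear (W : lmodType k) (f : H -> H -> W) :
  bilinear2 f -> linear (lift2 f).
Proof. by move/multilinear2/tlift_is_linear. Qed.

Lemma lift3_linear (W : lmodType k) (f : H -> H -> H -> W) :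
  trilinear3 f -> linear (lift3 f).
Proof. by move/multilinear3/tlift_is_linear. Qed.

Lemma lift2_ten2 (W : lmodType k) (f : H -> H -> W) a b :
  bilinear2 f -> lift2 f (ten2 a b) = f a b.
Proof. by move/multilinear2 => mf; rewrite /lift2 tlift_tpure. Qed.

Lemma lift3_ten3 (W : lmodType k) (f : H -> H -> H -> W) a b c :
  trilinear3 f -> lift3 f (ten3 a b c) = f a b c.
Proof. by move/multilinear3 => mf; rewrite /lift3 tlift_tpure. Qed.

Lemma eq_on_ten2 (W : lmodType k) (f g : tens H 2 -> W) :
  linear f -> linear g -> (forall a b, f (ten2 a b) = g (ten2 a b)) -> f =1 g.
Proof.
by move=> lf lg fg; apply: eq_on_tpure => // x; rewrite (tuple2E x); exact: fg.
Qed.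

Lemma eq_on_ten3 (W : lmodType k) (f g : tens H 3 -> W) :
  linear f -> linear g ->
  (forall a b c, f (ten3 a b c) = g (ten3 a b c)) -> f =1 g.
Proof.
by move=> lf lg fg; apply: eq_on_tpure => // x; rewrite (tuple3E x); exact: fg.
Qed.

Lemma tpure_tupd n (x y : n.-tuple H) (i : 'I_n) a :
  (forall j, (j < n)%N -> y`_j = if j == i :> nat then a else x`_j) ->
  tpure y = tpure (tupd x i a).
Proof.
move=> yE; congr tpure; apply: val_inj.
apply: (@eq_from_nth _ 0); rewrite ?size_tuple // => j jn.
by rewrite nth_tupd // yE.
Qed.

Lemma ten2_bilinear : bilinear2 (@ten2 k H).
Proof.
have upd0 (a b : H) : ten2 a b = tpure (tupd [tuple 0; b] ord0 a).
  by apply: tpure_tupd; do 2?case.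
have upd1 (a b : H) : ten2 a b = tpure (tupd [tuple a; 0] ord_max b).
  by apply: tpure_tupd; do 2?case.
split=> x a u v.
- by rewrite !upd0 tpure_multilinear.
- by rewrite !upd1 tpure_multilinear.
Qed.

Lemma ten3_trilinear : trilinear3 (@ten3 k H).
Proof.
have upd0 (a b c : H) : ten3 a b c = tpure (tupd [tuple 0; b; c] ord0 a).
  by apply: tpure_tupd; do 3?case.
have upd1 (a b c : H) :
    ten3 a b c = tpure (tupd [tuple a; 0; c] (Ordinal (isT : 1 < 3)%N) b).
  by apply: tpure_tupd; do 3?case.
have upd2 (a b c : H) : ten3 a b c = tpure (tupd [tuple a; b; 0] ord_max c).
  by apply: tpure_tupd; do 3?case.
split=> x y a u v.
- by rewrite !upd0 tpure_multilinear.
- by rewrite !upd1 tpure_multilinear.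
- by rewrite !upd2 tpure_multilinear.
Qed.

Lemma ten2M (a b a' b' : H) : ten2 a b * ten2 a' b' = ten2 (a * a') (b * b').
Proof.
rewrite [LHS]tpureM; congr tpure; apply: eq_from_tnth => i.
by rewrite tnth_mktuple !(tnth_nth 0); case: i => -[|[|//]].
Qed.

Lemma ten3M (a b c a' b' c' : H) :
  ten3 a b c * ten3 a' b' c' = ten3 (a * a') (b * b') (c * c').
Proof.
rewrite [LHS]tpureM; congr tpure; apply: eq_from_tnth => i.
by rewrite tnth_mktuple !(tnth_nth 0); case: i => -[|[|[|//]]].
Qed.

Lemma ten2_1 : ten2 1 1 = 1 :> tens H 2.
Proof.
rewrite -tpure1; congr tpure; apply: eq_from_tnth => i.
by rewrite tnth_mktuple (tnth_nth 0); case: i => -[|[|//]].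
Qed.

Lemma ten3_1 : ten3 1 1 1 = 1 :> tens H 3.
Proof.
rewrite -tpure1; congr tpure; apply: eq_from_tnth => i.
by rewrite tnth_mktuple (tnth_nth 0); case: i => -[|[|[|//]]].
Qed.

(** Both sides of the multiplicativity equation are linear in each of the two
    factors, so checking products of pure tensors suffices. *)
Lemma lift2_monoid_morphism (A : algType k) (f : H -> H -> A) :
  bilinear2 f -> f 1 1 = 1 ->
  (forall a b a' b', f (a * a') (b * b') = f a b * f a' b') ->
  monoid_morphism (lift2 f).
Proof.
move=> bf f1 fM; have lf := lift2_linear bf.
split=> [|x y]; first by rewrite -ten2_1 lift2_ten2.
move: x; apply: eq_on_ten2 => [c u v|c u v|a b].
- by rewrite mulrDl -scalerAl lf.
- by rewrite lf mulrDl -scalerAl.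
move: y; apply: eq_on_ten2 => [c u v|c u v|a' b'].
- by rewrite mulrDr -scalerAr lf.
- by rewrite lf mulrDr -scalerAr.
by rewrite ten2M !lift2_ten2.
Qed.

Lemma lift3_monoid_morphism (A : algType k) (f : H -> H -> H -> A) :
  trilinear3 f -> f 1 1 1 = 1 ->
  (forall a b c a' b' c',
     f (a * a') (b * b') (c * c') = f a b c * f a' b' c') ->
  monoid_morphism (lift3 f).
Proof.
move=> tf f1 fM; have lf := lift3_linear tf.
split=> [|x y]; first by rewrite -ten3_1 lift3_ten3.
move: x; apply: eq_on_ten3 => [d u v|d u v|a b c].
- by rewrite mulrDl -scalerAl lf.
- by rewrite lf mulrDl -scalerAl.
move: y; apply: eq_on_ten3 => [d u v|d u v|a' b' c'].
- by rewrite mulrDr -scalerAr lf.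
- by rewrite lf mulrDr -scalerAr.
by rewrite ten3M !lift3_ten3.
Qed.

End Multilinear.

(** * Legs and permutations are algebra morphisms *)

Section LegMorphisms.
Variables (k : fieldType) (H : algType k).

Let ten3_l1 := let: And3 l _ _ := ten3_trilinear H in l.
Let ten3_l2 := let: And3 _ l _ := ten3_trilinear H in l.
Let ten3_l3 := let: And3 _ _ l := ten3_trilinear H in l.

Fact flip_bilinear : bilinear2 (fun a b : H => ten2 b a).
Proof. by have [l1 l2] := ten2_bilinear H. Qed.
Fact leg12_bilinear : bilinear2 (fun a b : H => ten3 a b 1).
Proof. by split=> x; [exact: ten3_l1 | exact: ten3_l2]. Qed.
Fact leg13_bilinear : bilinear2 (fun a b : H => ten3 a 1 b).
Proof. by split=> x; [exact: ten3_l1 | exact: ten3_l3]. Qed.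
Fact leg23_bilinear : bilinear2 (fun a b : H => ten3 1 a b).
Proof. by split=> x; [exact: ten3_l2 | exact: ten3_l3]. Qed.

Fact perm132_trilinear : trilinear3 (fun a b c : H => ten3 a c b).
Proof. by split=> x y; [exact: ten3_l1 | exact: ten3_l3 | exact: ten3_l2]. Qed.
Fact perm213_trilinear : trilinear3 (fun a b c : H => ten3 b a c).
Proof. by split=> x y; [exact: ten3_l2 | exact: ten3_l1 | exact: ten3_l3]. Qed.
Fact perm231_trilinear : trilinear3 (fun a b c : H => ten3 b c a).
Proof. by split=> x y; [exact: ten3_l3 | exact: ten3_l1 | exact: ten3_l2]. Qed.
Fact perm312_trilinear : trilinear3 (fun a b c : H => ten3 c a b).
Proof. by split=> x y; [exact: ten3_l2 | exact: ten3_l3 | exact: ten3_l1]. Qed.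
Fact perm321_trilinear : trilinear3 (fun a b c : H => ten3 c b a).
Proof. by split=> x y; [exact: ten3_l3 | exact: ten3_l2 | exact: ten3_l1]. Qed.

HB.instance Definition _ := GRing.isLinear.Build k _ _ _ (@flip k H)
  (lift2_linear flip_bilinear).
HB.instance Definition _ := GRing.isLinear.Build k _ _ _ (@leg12 k H)
  (lift2_linear leg12_bilinear).
HB.instance Definition _ := GRing.isLinear.Build k _ _ _ (@leg13 k H)
  (lift2_linear leg13_bilinear).
HB.instance Definition _ := GRing.isLinear.Build k _ _ _ (@leg23 k H)
  (lift2_linear leg23_bilinear).
HB.instance Definition _ := GRing.isLinear.Build k _ _ _ (@perm132 k H)
  (lift3_linear perm132_trilinear).
HB.instance Definition _ := GRing.isLinear.Build k _ _ _ (@perm213 k H)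
  (lift3_linear perm213_trilinear).
HB.instance Definition _ := GRing.isLinear.Build k _ _ _ (@perm231 k H)
  (lift3_linear perm231_trilinear).
HB.instance Definition _ := GRing.isLinear.Build k _ _ _ (@perm312 k H)
  (lift3_linear perm312_trilinear).
HB.instance Definition _ := GRing.isLinear.Build k _ _ _ (@perm321 k H)
  (lift3_linear perm321_trilinear).

Fact leg12_monoid_morphism : monoid_morphism (@leg12 k H).
Proof.
apply: (lift2_monoid_morphism leg12_bilinear (ten3_1 H)) => *.
by rewrite ten3M mulr1.
Qed.
HB.instance Definition _ :=
  GRing.isMonoidMorphism.Build _ _ (@leg12 k H) leg12_monoid_morphism.

Fact leg23_monoid_morphism : monoid_morphism (@leg23 k H).
Proof.
apply: (lift2_monoid_morphism leg23_bilinear (ten3_1 H)) => *.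
by rewrite ten3M mulr1.
Qed.
HB.instance Definition _ :=
  GRing.isMonoidMorphism.Build _ _ (@leg23 k H) leg23_monoid_morphism.

Fact perm132_monoid_morphism : monoid_morphism (@perm132 k H).
Proof.
by apply: (lift3_monoid_morphism perm132_trilinear (ten3_1 H)) => *; rewrite ten3M.
Qed.
HB.instance Definition _ :=
  GRing.isMonoidMorphism.Build _ _ (@perm132 k H) perm132_monoid_morphism.

Fact perm213_monoid_morphism : monoid_morphism (@perm213 k H).
Proof.
by apply: (lift3_monoid_morphism perm213_trilinear (ten3_1 H)) => *; rewrite ten3M.
Qed.
HB.instance Definition _ :=
  GRing.isMonoidMorphism.Build _ _ (@perm213 k H) perm213_monoid_morphism.

Definition legE a b :=
  (lift2_ten2 a b flip_bilinear : flip (ten2 a b) = ten2 b a,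
   lift2_ten2 a b leg12_bilinear : leg12 (ten2 a b) = ten3 a b 1,
   lift2_ten2 a b leg13_bilinear : leg13 (ten2 a b) = ten3 a 1 b,
   lift2_ten2 a b leg23_bilinear : leg23 (ten2 a b) = ten3 1 a b).

Definition permE a b c :=
  (lift3_ten3 a b c perm132_trilinear : perm132 (ten3 a b c) = ten3 a c b,
   lift3_ten3 a b c perm213_trilinear : perm213 (ten3 a b c) = ten3 b a c,
   lift3_ten3 a b c perm231_trilinear : perm231 (ten3 a b c) = ten3 b c a,
   lift3_ten3 a b c perm312_trilinear : perm312 (ten3 a b c) = ten3 c a b,
   lift3_ten3 a b c perm321_trilinear : perm321 (ten3 a b c) = ten3 c b a).

Lemma perm213_leg12 (A : tens H 2) : perm213 (leg12 A) = leg12 (flip A).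
Proof.
by move: A; apply: eq_on_ten2 => [c u v|c u v|a b];
  rewrite ?linearP ?legE ?permE.
Qed.

Lemma perm213_leg13 (A : tens H 2) : perm213 (leg13 A) = leg23 A.
Proof.
by move: A; apply: eq_on_ten2 => [c u v|c u v|a b];
  rewrite ?linearP ?legE ?permE.
Qed.

Lemma perm213_leg23 (A : tens H 2) : perm213 (leg23 A) = leg13 A.
Proof.
by move: A; apply: eq_on_ten2 => [c u v|c u v|a b];
  rewrite ?linearP ?legE ?permE.
Qed.

Lemma perm213_perm231 (X : tens H 3) : perm213 (perm231 X) = perm321 X.
Proof.
by move: X; apply: eq_on_ten3 => [d u v|d u v|a b c]; rewrite ?linearP ?permE.
Qed.

Lemma perm213_perm132 (X : tens H 3) : perm213 (perm132 X) = perm312 X.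
Proof.
by move: X; apply: eq_on_ten3 => [d u v|d u v|a b c]; rewrite ?linearP ?permE.
Qed.

End LegMorphisms.

(** * The coproduct applied to the first factor *)

Section CoproductLeft.
Variables (k : fieldType) (H : algType k) (D : {lrmorphism H -> tens H 2}).

(** This factorization transfers properties of [D] to [D (x) id], because the
    elements [1 (x) 1 (x) b] commute with everything supported on the first
    two factors. *)
Lemma D_id_fiberE a b :
  lift2 (fun u v => ten3 u v b) (D a) = leg12 (D a) * ten3 1 1 b :> tens H 3.
Proof.
have [l1 l2 _] := ten3_trilinear H.
have bl : bilinear2 (fun u v : H => ten3 u v b).
  by split=> x; [exact: l1 | exact: l2].
move: (D a); apply: eq_on_ten2 => [|c u v|u v]; first exact: lift2_linear.
  by rewrite linearP mulrDl -scalerAl.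
by rewrite lift2_ten2 // legE ten3M !mulr1 mul1r.
Qed.

Lemma leg12_ten3_commute (X : tens H 2) b :
  leg12 X * ten3 1 1 b = ten3 1 1 b * leg12 X.
Proof.
move: X; apply: eq_on_ten2 => [c u v|c u v|u v].
- by rewrite linearP mulrDl -scalerAl.
- by rewrite linearP mulrDr -scalerAr.
by rewrite legE !ten3M !mulr1 !mul1r.
Qed.

Fact D_id_bilinear :
  bilinear2 (fun a b => lift2 (fun u v => ten3 u v b) (D a)).
Proof.
have [_ _ l3] := ten3_trilinear H.
split=> [b c u v|a c u v]; rewrite !D_id_fiberE.
  by rewrite !linearP mulrDl -scalerAl.
by rewrite l3 mulrDr -scalerAr.
Qed.

HB.instance Definition _ := GRing.isLinear.Build k _ _ _ (D_id D)
  (lift2_linear D_id_bilinear).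

Lemma D_id_ten2 a b : D_id D (ten2 a b) = leg12 (D a) * ten3 1 1 b.
Proof. by rewrite [LHS]lift2_ten2 ?D_id_fiberE //; exact: D_id_bilinear. Qed.

Fact D_id_monoid_morphism : monoid_morphism (D_id D).
Proof.
apply: lift2_monoid_morphism D_id_bilinear _ _ => [|a b a' b'].
  by rewrite D_id_fiberE !rmorph1 mul1r ten3_1.
rewrite !D_id_fiberE !rmorphM -!mulrA; congr (_ * _).
by rewrite [RHS]mulrA -leg12_ten3_commute -mulrA ten3M !mulr1.
Qed.
HB.instance Definition _ :=
  GRing.isMonoidMorphism.Build _ _ (D_id D) D_id_monoid_morphism.

Lemma leg12_commute (X A : tens H 2) :
  (forall h, X * D h = D h * X) -> leg12 X * D_id D A = D_id D A * leg12 X.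
Proof.
move=> XD; move: A; apply: eq_on_ten2 => [c u v|c u v|a b].
- by rewrite linearP mulrDr -scalerAr.
- by rewrite linearP mulrDl -scalerAl.
by rewrite D_id_ten2 mulrA -rmorphM XD rmorphM -!mulrA leg12_ten3_commute.
Qed.

(** The map [perm213] after [D (x) id] is [D^op (x) id], so this is
    quasi-cocommutativity in the first two factors while the third one is a
    spectator. *)
Lemma leg12_quasi_cocomm (R A : tens H 2) : R \is a GRing.unit ->
  (forall h, flip (D h) = R * D h * R^-1) ->
  leg12 R * D_id D A = perm213 (D_id D A) * leg12 R.
Proof.
move=> uR Rop; move: A; apply: eq_on_ten2 => [c u v|c u v|a b].
- by rewrite linearP mulrDr -scalerAr.
- by rewrite !linearP mulrDl -scalerAl.
rewrite D_id_ten2 rmorphM /= perm213_leg12 permE Rop -mulrA -leg12_ten3_commute.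
by rewrite !mulrA -!rmorphM mulrVK.
Qed.

End CoproductLeft.

(** * The infinitesimal Yang-Baxter equation *)

Section PreCartier.
Variables (k : fieldType) (H : preCartierQB k).

Local Notation R := (Rmx H).
Local Notation X := (chi H).
Local Notation F := (Phi H).
Local Notation DD := (D_id (Delta H)).

(** In the coproduct rule for [chi], the terms [chi13] and [chi23] are conjugated
    by [Phi132^-1 R23 Phi] and by [Phi], the final factors of the hexagon for
    [R]; multiplying the two formulas thus inserts [chi13] and [chi23] inside
    the hexagon product, right after [R13] and [R23]. *)
Lemma D_id_Rchi :
  DD (R * X) =
    perm231 F * leg13 R * leg13 X * (perm132 F)^-1 * leg23 R * F
  + perm231 F * leg13 R * (perm132 F)^-1 * leg23 R * leg23 X * F.
Proof.
have uR : leg23 R \is a GRing.unit by apply: rmorph_unit; exact: Rmx_unit.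
have uF : F \is a GRing.unit by exact: Phi_unit.
have uF' : perm132 F \is a GRing.unit by exact: rmorph_unit.
rewrite rmorphM /= hexagon_l chi_l mulrDr !mulrA !(mulrK uF).
by rewrite (mulrK uR) (mulrVK uF').
Qed.

Lemma perm213_D_id_R :
  perm213 (DD R) =
    perm321 F * leg23 R * (perm312 F)^-1 * leg13 R * perm213 F.
Proof.
rewrite hexagon_l !rmorphM /= rmorphV /=; last by apply: rmorph_unit; exact: Phi_unit.
by rewrite perm213_perm231 perm213_leg13 perm213_perm132 perm213_leg23.
Qed.

Lemma perm213_D_id_Rchi :
  perm213 (DD (R * X)) =
    perm321 F * leg23 R * leg23 X * (perm312 F)^-1 * leg13 R * perm213 F
  + perm321 F * leg23 R * (perm312 F)^-1 * leg13 R * leg13 X * perm213 F.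
Proof.
rewrite D_id_Rchi rmorphD !rmorphM /= rmorphV /=; last first.
  by apply: rmorph_unit; exact: Phi_unit.
by rewrite perm213_perm231 !perm213_leg13 perm213_perm132 !perm213_leg23.
Qed.

End PreCartier.

Theorem theorem3p18 (k : fieldType) (char_k0 : [pchar k] =i pred0)
    (H : preCartierQB k) :
    leg12 (Rmx H) * leg12 (chi H) * perm231 (Phi H) * leg13 (Rmx H)
      * (perm132 (Phi H))^-1 * leg23 (Rmx H) * Phi H
  + leg12 (Rmx H) * perm231 (Phi H) * leg13 (Rmx H) * leg13 (chi H)
      * (perm132 (Phi H))^-1 * leg23 (Rmx H) * Phi H
  + leg12 (Rmx H) * perm231 (Phi H) * leg13 (Rmx H)
      * (perm132 (Phi H))^-1 * leg23 (Rmx H) * leg23 (chi H) * Phi H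
  = perm321 (Phi H) * leg23 (Rmx H) * leg23 (chi H)
      * (perm312 (Phi H))^-1 * leg13 (Rmx H) * perm213 (Phi H) * leg12 (Rmx H)
  + perm321 (Phi H) * leg23 (Rmx H) * (perm312 (Phi H))^-1
      * leg13 (Rmx H) * leg13 (chi H) * perm213 (Phi H) * leg12 (Rmx H)
  + perm321 (Phi H) * leg23 (Rmx H) * (perm312 (Phi H))^-1
      * leg13 (Rmx H) * perm213 (Phi H) * leg12 (Rmx H) * leg12 (chi H).
Proof.
have R_op A : leg12 (Rmx H) * D_id (Delta H) A
    = perm213 (D_id (Delta H) A) * leg12 (Rmx H).
  by apply: leg12_quasi_cocomm; [exact: Rmx_unit | exact: quasi_cocomm].
transitivity (leg12 (Rmx H) * (leg12 (chi H) * D_id (Delta H) (Rmx H)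
                               + D_id (Delta H) (Rmx H * chi H))).
  by rewrite hexagon_l D_id_Rchi !mulrDr !mulrA addrA.
(* Moving [chi12] and then [R12] to the right past the coproducts leaves only
   [perm213] images, to be expanded. *)
rewrite leg12_commute; last exact: chi_comm.
rewrite mulrDr mulrA !R_op perm213_D_id_R perm213_D_id_Rchi mulrDl.
by rewrite addrC.
Qed.
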